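(* Let $X=[0,1]$ with the Euclidean metric, $T(x)=2x \bmod 1$, and $\mu$ Lebesgue measure. Let $(r_n)_n$ be a decreasing sequence of positive numbers such that $(nr_n)_n$ is also decreasing. Then \[ (\mu\times\mu)(\limsup_n E_{n,r_n}^T)=\begin{cases}0 & \text{if } \sum_{n=1}^\infty nr_n<\infty,\\ 1 & \text{if } \sum_{n=1}^\infty nr_n=\infty.\end{cases} \]
   Context: For $n\in\mathbb{N}$ and $r>0$, $E_{n,r}^{T}:=\{(x,y)\in X\times X : |T^i x- T^j y|<r \text{ for some } 0\le i,j<n\}$; $E_{n,r_n}^T$ is this set with $r=r_n$. *)

(* Defs.v *)
From HB Require Import structures.
From mathcomp Require Import all_boot all_order all_algebra.
From mathcomp Require Import all_classical all_reals all_analysis.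
Unset Strict Implicit. Unset Printing Implicit Defensive.
Import Order.TTheory GRing.Theory Num.Theory.
Import numFieldNormedType.Exports.
Local Open Scope classical_set_scope.
Local Open Scope ring_scope.

Definition unitI (R : realType) : set R := `[0, 1]%classic.

Definition doubling (R : realType) (x : R) : R :=
  2 * x - (Num.floor (2 * x))%:~R.

Definition E_set (R : realType) (n : nat) (r : R) : set (R * R) :=
  [set p | unitI R p.1 /\ unitI R p.2 /\
     exists i j : nat, [/\ (i < n)%N, (j < n)%N &
        `|iter i (@doubling R) p.1 - iter j (@doubling R) p.2| < r]].

Definition limsup_set {T : Type} (E : nat -> set T) : set T :=
  [set p | forall N : nat, exists2 n : nat, (N <= n)%N & E n p].

Definition muX (R : realType) :=
  mrestr (@lebesgue_measure R) (measurable_itv `[(0:R), 1]).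

(* Main.v *)
Require Import Defs.
From HB Require Import structures.
From mathcomp Require Import all_boot all_order all_algebra.
From mathcomp Require Import all_classical all_reals all_analysis.
From mathcomp Require Import measurable_realfun.
From mathcomp Require Import zify ring lra.
Import Order.TTheory GRing.Theory Num.Theory.
Import numFieldNormedType.Exports.

(** Convergence: a pair that lies in infinitely many [E_n] has either infinitely
    many [q] with [|T^i x - T^j y| < r_q] for some [i, j] with
    [max(i, j) = q - 1], an event of measure [O(q r_q)], or a fixed finite range
    of pairs [(i, j)] for which [|T^i x - T^j y|] drops below every [r_n]; so
    the tail of the series bounds the measure.

    Divergence: let [2^-m_n] be comparable to [r_n].  For [j <= i] consider the
    event that the binary digits of [x] and [y] differ at positions [i] and [j]
    and then agree for [m_(i+2)] further positions; it puts [(x, y)] in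
    [E_(i+2)].  Two such events on different diagonals [i - j] are independent,
    since the corresponding graph of digit equations is a forest; on the same
    diagonal they are independent or, thanks to the initial disagreement,
    disjoint.  Hence the number of these events that occur has variance at most
    its mean, which is comparable to the partial sums of [n r_n], and by
    Chebyshev's inequality almost surely infinitely many of them occur. *)

(** * Counting pairs of binary words that satisfy digit equations *)

Section Bits.
Variable M : nat.
Notation W := (M.-tuple bool * M.-tuple bool)%type.

(** The pattern [c] prescribes where the digits differ, so agreement and disagreement are parity
    equations of one kind. *)
Definition digits_differ_by (i j m : nat) (c : nat -> bool) : pred W :=
  fun w => [forall s : 'I_m,
    nth false w.1 (i + s) (+) nth false w.2 (j + s) == c s].

Lemma digits_differ_byP i j m c (w : W) :
  reflect (forall s, s < m ->
             nth false w.1 (i + s) (+) nth false w.2 (j + s) = c s)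
          (digits_differ_by i j m c w).
Proof.
apply: (iffP forallP) => [h s sm|h s]; last by rewrite h.
exact: (eqP (h (Ordinal sm))).
Qed.

Lemma digits_differ_byS i j m c (w : W) :
  digits_differ_by i j m.+1 c w =
  digits_differ_by i j m c w
    && (nth false w.1 (i + m) (+) nth false w.2 (j + m) == c m).
Proof.
apply/digits_differ_byP/andP => [h|[/digits_differ_byP h /eqP hm] s].
  by split; [apply/digits_differ_byP => s sm; apply: h; lia|rewrite h].
by rewrite ltnS leq_eqVlt => /predU1P[->|/h].
Qed.

Lemma digits_differ_by0 i j c (w : W) : digits_differ_by i j 0 c w.
Proof. by apply/digits_differ_byP. Qed.

Definition flip_bit (a : nat) (t : M.-tuple bool) : M.-tuple bool :=
  [tuple (nth false t i) (+) (val i == a) | i < M].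

Lemma nth_flip_bit a (t : M.-tuple bool) k : a < M ->
  nth false (flip_bit a t) k = nth false t k (+) (k == a).
Proof.
move=> aM; have [kM|Mk] := ltnP k M.
  by rewrite (nth_mktuple _ _ (Ordinal kM)).
rewrite !nth_default ?size_tuple //=; apply/esym/eqP; lia.
Qed.

Lemma flip_bitK a : a < M -> involutive (flip_bit a).
Proof.
move=> aM t; apply: val_inj; apply: (@eq_from_nth _ false).
  by rewrite !size_tuple.
by move=> k _; rewrite !nth_flip_bit// -addbA addbb addbF.
Qed.

(** The involution [f] exchanges the points of [P] inside [Q] with those outside. *)
Lemma card_halving (T : finType) (f : T -> T) (P Q : pred T) :
  involutive f -> (forall w, P (f w) = P w) -> (forall w, Q (f w) = ~~ Q w) ->
  (2 * #|[pred w | P w && Q w]|)%N = #|P|.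
Proof.
move=> fK Pf Qf; rewrite -(cardID Q P) mul2n -addnn; congr addn.
rewrite -(fintype.card_image (inv_inj fK)); apply: eq_card => w.
have inP A x : (x \in A) = (A x) :> bool by [].
apply/fintype.imageP/idP => [[v]|]; rewrite !inE !inP => /andP[Pv Qv].
  by move=> ->; rewrite Qf Pf Pv Qv.
by exists (f w); [rewrite !inE ?inP Pf Qf Pv Qv|rewrite fK].
Qed.

Lemma digits_differ_by_flip1 a i j m c (w : W) : a < M ->
  (forall s, s < m -> i + s != a) ->
  digits_differ_by i j m c (flip_bit a w.1, w.2) = digits_differ_by i j m c w.
Proof.
move=> aM ia; apply/digits_differ_byP/digits_differ_byP => h s sm;
  by rewrite -(h s sm) /= nth_flip_bit// (negPf (ia s sm)) addbF.
Qed.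

Lemma digits_differ_by_flip2 b i j m c (w : W) : b < M ->
  (forall s, s < m -> j + s != b) ->
  digits_differ_by i j m c (w.1, flip_bit b w.2) = digits_differ_by i j m c w.
Proof.
move=> bM jb; apply/digits_differ_byP/digits_differ_byP => h s sm;
  by rewrite -(h s sm) /= nth_flip_bit// (negPf (jb s sm)) addbF.
Qed.

(* The equations form a forest: the last equation on one of the two diagonals
   contains a digit that no other equation mentions, and flipping it shows
   that this equation halves the number of solutions. *)
Lemma card_two_diagonals i j m c i' j' m' c' :
  i + m <= M -> j + m <= M -> i' + m' <= M -> j' + m' <= M ->
  (j + i' < j' + i) || (j + i' == j' + i) && (i + m <= i') ->
  2 ^ (m + m') *
    #|[pred w | digits_differ_by i j m c w && digits_differ_by i' j' m' c' w]|
  = 4 ^ M.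
Proof.
have [k km] := ubnP (m + m').
elim: k => // k IH in m m' km *.
move=> him hjm him' hjm' hd.
(* The last equation reaching farther in [w.1] is dropped. If it is that of the second system, ties
   included, the larger offset [j' - i'], or disjointness on a common diagonal, puts its digit of
   [w.2] beyond the first system. Otherwise its digit of [w.1] is free. *)
have [/andP[]|h] := boolP ((0 < m') && ((m == 0) || (i + m <= i' + m'))).
  case: m' => // m' in km him' hjm' * => _ h.
  apply: etrans (IH m m' _ _ _ _ _ _); try lia.
  rewrite addnS expnSr -mulnA; congr muln.
  have bM : j' + m' < M by lia.
  rewrite -[RHS](@card_halving _ (fun w : W => (w.1, flip_bit (j' + m') w.2)) _
    (fun w => nth false w.1 (i' + m') (+) nth false w.2 (j' + m') == c' m')).
  - congr muln; apply: eq_card => w; rewrite !inE digits_differ_byS.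
    by rewrite andbA.
  - by move=> [x y]; rewrite /= flip_bitK.
  - by move=> w /=; rewrite !digits_differ_by_flip2// => s sm; lia.
  - move=> w; rewrite /= nth_flip_bit// eqxx.
    by case: nth (nth _ _ _) (c' m') => [] [] [].
case: m => [|m] in km him hjm hd h *.
  case: m' => [|m'] in km him' hjm' h *; last by lia.
  rewrite mul1n (eq_card (B := predT)); last first.
    by move=> w; rewrite !inE !digits_differ_by0.
  by rewrite cardT -cardE card_prod !card_tuple card_bool -expnMn.
apply: etrans (IH m m' _ _ _ _ _ _); try lia.
rewrite addSn expnSr -mulnA; congr muln.
have aM : i + m < M by lia.
rewrite -[RHS](@card_halving _ (fun w : W => (flip_bit (i + m) w.1, w.2)) _
  (fun w => nth false w.1 (i + m) (+) nth false w.2 (j + m) == c m)).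
- congr muln; apply: eq_card => w; rewrite !inE digits_differ_byS.
  by rewrite andbAC.
- by move=> [x y]; rewrite /= flip_bitK.
- by move=> w /=; rewrite !digits_differ_by_flip1// => s sm; lia.
- move=> w; rewrite /= nth_flip_bit// eqxx.
  by case: nth (nth _ _ _) (c m) => [] [] [].
Qed.

(** The digits differ at the first position and agree at the next [m], whence [m.+1] equations. *)
Definition new_match (i j m : nat) : pred W :=
  digits_differ_by i j m.+1 (fun s => s == 0).

Lemma card_new_match i j m : i + m < M -> j + m < M ->
  2 ^ m.+1 * #|new_match i j m| = 4 ^ M.
Proof.
move=> hi hj.
have := @card_two_diagonals i j 0 xpred0 i j m.+1 (fun s => s == 0).
rewrite !addnS => <-; try lia.
congr muln; apply: eq_card => w.
by rewrite [in RHS]inE digits_differ_by0 [LHS]unfold_in.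
Qed.

Lemma card_new_matchI i j m i' j' m' :
  i + m < M -> j + m < M -> i' + m' < M -> j' + m' < M ->
  (i, j) != (i', j') ->
  #|[pred w | new_match i j m w && new_match i' j' m' w]| * 4 ^ M
    <= #|new_match i j m| * #|new_match i' j' m'|.
Proof.
move=> hi hj hi' hj' neq.
wlog : i j m i' j' m' hi hj hi' hj' neq /
    (j + i' < j' + i) || (j + i' == j' + i) && (i < i').
  move=> H; have [|h] := boolP ((j + i' < j' + i) || (j + i' == j' + i) && (i < i')).
    exact: H.
  rewrite [leqRHS]mulnC; rewrite (eq_card (B := [pred w | new_match i' j' m' w &&
      new_match i j m w])); last by move=> w; rewrite !inE andbC.
  by apply: H => //; move: neq h; rewrite ?xpair_eqE; lia.
move=> hd.
(* When two runs on one diagonal overlap, the later one demands disagreement at a position where the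
   earlier one demands agreement. *)
have [ov|nov] := boolP ((j + i' == j' + i) && (i' <= i + m)).
  rewrite eq_card0 ?mul0n// => w; rewrite !inE; apply/negP => /andP[].
  move=> /digits_differ_byP /(_ (i' - i)) h1 /digits_differ_byP /(_ 0 isT).
  have [-> ->] : i' + 0 = i + (i' - i) /\ j' + 0 = j + (i' - i) by lia.
  by rewrite h1; lia.
have := @card_two_diagonals i j m.+1 (fun s => s == 0) i' j' m'.+1 (fun s => s == 0).
have := card_new_match _ _ _ hi hj; have := card_new_match _ _ _ hi' hj'.
set A := #|new_match i j m|; set B := #|new_match i' j' m'|.
rewrite -/(new_match i j m) -/(new_match i' j' m').
set C := #|_| => eB eA eC.
have {}eC : 2 ^ (m.+1 + m'.+1) * C = 4 ^ M by apply: eC; lia.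
rewrite -(@leq_pmul2l (2 ^ (m.+1 + m'.+1))) ?expn_gt0//.
rewrite mulnA eC expnD mulnACA eA eB leqnn//.
Qed.
End Bits.

(** * Second moment method for negatively correlated events on a finite set *)

Section SecondMoment.
Local Open Scope ring_scope.
Variables (T I : finType) (A : I -> pred T).
Hypothesis neg_corr : forall p q, p != q ->
  (#|[pred w | A p w && A q w]| * #|T| <= #|A p| * #|A q|)%N.

(* Chebyshev: the number of events that occur has variance at most its mean. *)
Lemma card_no_event :
  (#|[pred w | [forall p, ~~ A p w]]| * (\sum_p #|A p|) <= #|T| ^ 2)%N.
Proof.
set N := #|_|; set S := (\sum_p _)%N.
have [->|S0] := posnP S; first by rewrite muln0.
have T0 : (0 < #|T|)%N.
  rewrite lt0n; apply/eqP => T0; move: S0; rewrite /S big1// => p _.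
  by apply/eqP; rewrite -leqn0 -T0 max_card.
pose Z w : rat := \sum_p (A p w)%:R.
have cardE (B : pred T) : \sum_w (B w)%:R = #|B|%:R :> rat.
  by rewrite -sum1_card natr_sum [RHS]big_mkcond/=; apply: eq_bigr => w _;
    rewrite unfold_in; case: (B w).
have EZ : \sum_w Z w = S%:R.
  by rewrite exchange_big natr_sum; apply: eq_bigr => p _; rewrite cardE.
have EZ2 : #|T|%:R * (\sum_w Z w ^+ 2) <= S%:R ^+ 2 + #|T|%:R * S%:R.
  have -> : \sum_w Z w ^+ 2 = \sum_p \sum_q #|[pred w | A p w && A q w]|%:R.
    under eq_bigr do rewrite expr2 mulr_suml.
    rewrite exchange_big; apply: eq_bigr => p _.
    under eq_bigr do rewrite mulr_sumr.
    rewrite exchange_big; apply: eq_bigr => q _.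
    by rewrite -cardE; apply: eq_bigr => w _ /=; rewrite -natrM mulnb.
  rewrite /S expr2 natr_sum mulr_suml 2!mulr_sumr -big_split/=.
  (* Off the diagonal [neg_corr] applies; the term [q = p] on the left costs at most
     [#|T| * #|A p|]. *)
  apply: ler_sum => p _; rewrite !mulr_sumr (bigD1 p)//= [in leRHS](bigD1 p)//=.
  rewrite addrC; apply: lerD.
    rewrite -[leLHS]add0r; apply: lerD; first by rewrite mulr_ge0 ?ler0n.
    apply: ler_sum => q qp; rewrite -!natrM ler_nat mulnC.
    by apply: neg_corr; rewrite eq_sym.
  rewrite -!natrM ler_nat leq_mul2l; apply/orP; right.
  by apply/subset_leq_card/fintype.subsetP => w; rewrite !inE => /andP[].
have var : \sum_w (#|T|%:R * Z w - S%:R) ^+ 2 <= #|T|%:R ^+ 2 * S%:R.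
  have -> : \sum_w (#|T|%:R * Z w - S%:R) ^+ 2 =
      #|T|%:R ^+ 2 * (\sum_w Z w ^+ 2) - 2 * #|T|%:R * S%:R * S%:R
      + #|T|%:R * S%:R ^+ 2.
    have -> : #|T|%:R * S%:R ^+ 2 = \sum_(w : T) S%:R ^+ 2 :> rat.
      by rewrite sumr_const mulr_natl.
    rewrite -[X in _ - _ * X]EZ !mulr_sumr -sumrB -big_split/=.
    by apply: eq_bigr => w _; ring.
  have : #|T|%:R * (#|T|%:R * \sum_w Z w ^+ 2) <= #|T|%:R * (S%:R ^+ 2 + #|T|%:R * S%:R).
    by rewrite ler_wpM2l.
  set t : rat := #|T|%:R; set z := \sum_w _; set u : rat := S%:R.
  by move=> H; nra.
(* Where no event occurs, [Z w = 0] and the squared deviation is [S ^ 2]. *)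
have : N%:R * S%:R ^+ 2 <= #|T|%:R ^+ 2 * S%:R :> rat.
  apply: le_trans var; rewrite -cardE mulr_suml; apply: ler_sum => w _ /=.
  have [/forallP Aw|_] := boolP [forall p, ~~ A p w]; last by rewrite mul0r sqr_ge0.
  by rewrite /Z big1 ?mulr0 ?sub0r ?sqrrN ?mul1r// => p _; rewrite (negPf (Aw p)).
by rewrite expr2 mulrA ler_pM2r ?ltr0n// -natrX -natrM ler_nat.
Qed.
End SecondMoment.

Local Open Scope classical_set_scope.
Local Open Scope ring_scope.

(** * Binary digits, orbits of the doubling map and measurability *)

Section Digits.
Variable R : realType.
Implicit Types (x y : R) (i j m : nat).
Local Notation T := (@doubling R).

Lemma doubling_itv x : 0 <= T x < 1.
Proof.
have := floor_itv (2 * x); rewrite /doubling intrD => /andP[h1 h2].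
by apply/andP; split; lra.
Qed.

Lemma iter_doubling_ge0 i x : 0 <= x -> 0 <= iter i T x.
Proof. by case: i => // i _; case/andP: (doubling_itv (iter i T x)). Qed.

(** For [x >= 0] all the floors removed are nonnegative; a natural [k] can later index the affine
    branches of the iterate. *)
Lemma iter_doublingE i x : 0 <= x ->
  exists k : nat, iter i T x = 2 ^+ i * x - k%:R.
Proof.
move=> x0; elim: i => [|i [k IH]]; first by exists 0%N; rewrite mul1r subr0.
have y0 := iter_doubling_ge0 i _ x0.
have : 0 <= Num.floor (2 * iter i T x) by rewrite floor_ge0 mulr_ge0.
rewrite iterS {2}/doubling; case: (Num.floor _) => // l _.
exists (2 * k + l)%N; rewrite IH exprS natrD natrM -pmulrn; ring.
Qed.

Definition digit x i : bool := 2^-1 <= iter i T x.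

Lemma digit_iter x i s : digit (iter i T x) s = digit x (i + s)%N.
Proof. by rewrite /digit -iterD addnC. Qed.

Lemma doublingE x : 0 <= x < 1 -> T x = 2 * x - (digit x 0)%:R.
Proof.
move=> /andP[x0 x1]; rewrite /doubling /digit /=; congr (_ - _).
have [h|h] := leP 2^-1 x.
  by rewrite (_ : Num.floor _ = 1)//; apply/eqP; rewrite floor_eq; apply/andP; split; lra.
by rewrite (_ : Num.floor _ = 0)//; apply/eqP; rewrite floor_eq; apply/andP; split; lra.
Qed.

(** The number with binary expansion [0.s], in Horner form. *)
Fixpoint dyadic (s : seq bool) : R :=
  if s is b :: s' then (b%:R + dyadic s') / 2 else 0.

Lemma dyadic_digits m x : 0 <= x < 1 ->
  dyadic (mkseq (digit x) m) <= x < dyadic (mkseq (digit x) m) + 2^-1 ^+ m.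
Proof.
elim: m x => [|m IH] x x01; first by rewrite /= add0r.
rewrite /mkseq /= (iotaDl 1 0) -map_comp.
(* The digits of [x] after the first are the digits of [T x]. *)
rewrite (@eq_map _ _ _ (digit (T x))); last first.
  by move=> k; rewrite /= -(digit_iter x 1).
have := IH (T x) (doubling_itv x); rewrite /mkseq doublingE// exprS.
by move=> /andP[h1 h2]; apply/andP; split; lra.
Qed.

(** Both points lie in the same half-open dyadic interval of length [2^-m]. *)
Lemma close_of_digits m x y : 0 <= x < 1 -> 0 <= y < 1 ->
  (forall s, (s < m)%N -> digit x s = digit y s) -> `|x - y| < 2^-1 ^+ m.
Proof.
move=> x01 y01 xy.
have := dyadic_digits m _ x01; have := dyadic_digits m _ y01.
have -> : mkseq (digit x) m = mkseq (digit y) m.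
  by apply/eq_in_map => s; rewrite mem_iota => /xy.
move=> /andP[h1 h2] /andP[h3 h4]; rewrite ltr_norml; apply/andP; split; lra.
Qed.

Lemma measurable_iter_doubling i : measurable_fun [set: R] (iter i T).
Proof.
elim: i => [|i IH]; first exact: measurable_id.
apply: (@measurableT_comp _ _ _ _ _ _ T) => //.
apply: measurable_funB; first exact: measurable_funM.
apply: nondecreasing_measurable => // x y xy.
by rewrite ler_int le_floor// ler_wpM2l.
Qed.

Definition close_orbits i j (e : R) : set (R * R) :=
  [set p | `|iter i T p.1 - iter j T p.2| < e].

Lemma measurable_close_orbits i j e : measurable (close_orbits i j e).
Proof.
rewrite (_ : close_orbits _ _ _ = [set: R * R] `&`
   (fun p : R * R => `|iter i T p.1 - iter j T p.2| < e) @^-1` [set true]); last first.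
  by rewrite setTI; apply/seteqP; split.
apply: measurable_fun_ltr => //.
apply: measurableT_comp => //; apply: measurable_funB.
  exact: measurableT_comp (measurable_iter_doubling i) _.
exact: measurableT_comp (measurable_iter_doubling j) _.
Qed.

Lemma E_setE n e : E_set R n e =
  (unitI R `*` unitI R) `&` \bigcup_(i < n) \bigcup_(j < n) close_orbits i j e.
Proof.
apply/seteqP; split => -[x y] /=.
  by move=> [? [? [i [j [ni nj ?]]]]]; split=> //; exists i => //; exists j.
by move=> [[? ?] [i ni [j nj ?]]]; do 2!split=> //; exists i, j.
Qed.

Lemma measurable_E_set n e : measurable (E_set R n e).
Proof.
rewrite E_setE; apply: measurableI.
  by apply: measurableX; exact: measurable_itv.
apply: bigcup_measurable => i _; apply: bigcup_measurable => j _.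
exact: measurable_close_orbits.
Qed.

Lemma limsup_setE (F : nat -> set (R * R)) :
  limsup_set F = \bigcap_N \bigcup_(n >= N) F n.
Proof.
apply/seteqP; split => p.
  by move=> h N _; have [n Nn Fn] := h N; exists n.
by move=> h N; have [n Nn Fn] := h N I; exists n.
Qed.

Lemma measurable_limsup (F : nat -> set (R * R)) :
  (forall n, measurable (F n)) -> measurable (limsup_set F).
Proof.
move=> mF; rewrite limsup_setE; apply: bigcapT_measurable => N.
by apply: bigcup_measurable => n _.
Qed.
End Digits.

(** * Lebesgue measure on the unit interval and the measure of a close encounter *)

Section UnitMeasure.
Variable R : realType.
Local Open Scope ereal_scope.
Local Notation T := (@doubling R).

HB.instance Definition _ := Measure.copy (muX R)
  (mrestr (@lebesgue_measure R) (measurable_itv `[0%R : R, 1%R])).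

Lemma muX_setT : muX R setT = 1.
Proof.
by rewrite /muX /mrestr setTI lebesgue_measure_itv /= lte_fin ltr01 oppr0 adde0.
Qed.

HB.instance Definition _ := Measure_isProbability.Build _ _ _ (muX R) muX_setT.

Definition muX2 : probability _ R := (muX R \x muX R).

Lemma muX_le (A : set R) : measurable A -> muX R A <= lebesgue_measure A.
Proof.
move=> mA; rewrite /muX /mrestr; apply: le_measure; rewrite ?inE//.
by apply: measurableI => //; exact: measurable_itv.
Qed.

Lemma muX_itv_le (a b : bool) (x y : R) : (x <= y)%R ->
  muX R [set` Interval (BSide a x) (BSide b y)] <= (y - x)%:E.
Proof.
move=> xy; apply: le_trans (muX_le _ (measurable_itv _)) _.
rewrite lebesgue_measure_itv /= lte_fin; case: ifP => _.
  by rewrite EFinB.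
by rewrite lee_fin subr_ge0.
Qed.

Lemma muX_not_co01 : muX R (~` `[0%R, 1%R[%classic) = 0.
Proof.
apply/eqP; rewrite eq_le measure_ge0 andbT.
rewrite -(@lebesgue_measure_set1 R 1%R) /muX /mrestr; apply: le_measure; rewrite ?inE.
- apply: measurableI; last exact: measurable_itv.
  by apply: measurableC; exact: measurable_itv.
- exact: measurable_set1.
- move=> x []; rewrite /= !in_itv /= => /negP h /andP[x0 x1].
  by apply/eqP; rewrite eq_le x1 leNgt; move: h; rewrite x0 /= => ->.
Qed.

(* The factor 4 rather than 2 absorbs the branch [2 ^ j * y - 2 ^ j], needed
   only at [y = 1]. *)
Lemma muX_close_le j (a e : R) : (0 < e)%R ->
  muX R [set y | `|a - iter j T y| < e]%R <= (4 * e)%:E.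
Proof.
move=> e0.
(* [J k] is where the branch [2 ^ j * y - k] comes within [e] of [a]. *)
pose J (k : nat) := `](a + k%:R - e) / 2 ^+ j, (a + k%:R + e) / 2 ^+ j[%classic%R.
have p0 : (0 < 2 ^+ j :> R)%R by rewrite exprn_gt0.
have mS : measurable ([set y | `|a - iter j T y| < e]%R : set R).
  rewrite (_ : mkset _ = [set: R] `&`
   (fun y => `|a - iter j T y| < e)%R @^-1` [set true]); last first.
    by rewrite setTI; apply/seteqP; split.
  apply: measurable_fun_ltr => //.
  apply: measurableT_comp => //; apply: measurable_funB => //.
  exact: measurable_iter_doubling.
have -> : muX R [set y | `|a - iter j T y| < e]%R =
    muX R ([set y | `|a - iter j T y| < e]%R `&` `[0%R, 1%R]).
  by rewrite /muX /mrestr -setIA setIid.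
apply: (@le_trans _ _ (\sum_(k < (2 ^ j).+1) muX R (J k))).
  apply: content_subadditive => [k _||].
  - exact: measurable_itv.
  - by apply: measurableI => //; exact: measurable_itv.
  - move=> y [/= ye]; rewrite in_itv/= => /andP[y0 y1].
    have [k jk] := iter_doublingE R j _ y0.
    have jy0 := iter_doubling_ge0 R j _ y0.
    have kj : (k < (2 ^ j).+1)%N.
      rewrite ltnS -(ler_nat R) natrX; rewrite jk subr_ge0 in jy0.
      by apply: le_trans jy0 _; rewrite ler_piMr// ltW.
    rewrite -bigcup_mkord; exists k => //.
    rewrite /J /= in_itv /= ltr_pdivrMr// ltr_pdivlMr//.
    by move: ye; rewrite jk ltr_norml => /andP[? ?]; apply/andP; split; lra.
apply: (@le_trans _ _ (\sum_(k < (2 ^ j).+1) (2 * e / 2 ^+ j)%:E)).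
  apply: lee_sum => k _; apply: le_trans (muX_itv_le _ _ _ _ _) _.
    by rewrite ler_pM2r ?invr_gt0//; lra.
  by rewrite lee_fin le_eqVlt; apply/orP; left; apply/eqP; field; exact: lt0r_neq0.
rewrite sumEFin lee_fin sumr_const card_ord -[leLHS]mulr_natr.
rewrite mulrAC ler_pdivrMr// -(natr1 (2 ^ j)%N) natrX.
have : (1 <= 2 ^+ j :> R)%R by rewrite exprn_ege1// ler1n.
nra.
Qed.

(** By Fubini: each section at fixed [x] is bounded by [muX_close_le], uniformly in [x]. *)
Lemma muX2_close_le i j (e : R) : (0 < e)%R ->
  muX2 (close_orbits R i j e) <= (4 * e)%:E.
Proof.
move=> e0; rewrite /muX2 /= /product_measure1.
have m := measurable_close_orbits R i j e.
apply: (@le_trans _ _ (\int[muX R]_x (cst (4 * e)%:E x))); last first.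
  by rewrite integral_cst//= [X in _ * X]muX_setT mule1.
apply: ge0_le_integral => //=.
- exact: measurable_fun_xsection.
- by move=> x _; rewrite xsectionE; exact: (muX_close_le j (iter i T x) _ e0).
Qed.

End UnitMeasure.

(** * Convergent series: the limsup is null *)

Section Convergence.
Variables (R : realType) (r : nat -> R).
Hypothesis r_pos : forall n : nat, (0 < n)%N -> 0 < r n.
Hypothesis r_dec : forall n m : nat, (0 < n)%N -> (n <= m)%N -> r m <= r n.
Hypothesis nr_dec : forall n m : nat, (0 < n)%N -> (n <= m)%N ->
  m%:R * r m <= n%:R * r n.
Local Notation limsupE := (limsup_set (fun n => @E_set R n (r n))).
Local Open Scope ereal_scope.

Let r_pos' n : (0 <= n%:R * r n)%R.
Proof. by case: n => [|n]; rewrite ?mul0r// mulr_ge0// ltW// r_pos. Qed.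

(** Encounters at times with maximum [q - 1]; [q] is the first index whose [E_q] admits these times,
    so [r q] is the largest radius they meet. *)
Let border q : set (R * R) := \big[setU/set0]_(i < q)
  (close_orbits R i q.-1 (r q) `|` close_orbits R q.-1 i (r q)).

Let box N (e : R) : set (R * R) :=
  \big[setU/set0]_(i < N) \big[setU/set0]_(j < N) close_orbits R i j e.

Let measurable_border q : measurable (border q).
Proof.
apply: bigsetU_measurable => i _.
by apply: measurableU; exact: measurable_close_orbits.
Qed.

Let measurable_box N e : measurable (box N e).
Proof.
apply: bigsetU_measurable => i _; apply: bigsetU_measurable => j _.
exact: measurable_close_orbits.
Qed.

Let border_le q : muX2 R (border q) <= (8 * (q%:R * r q))%:E.
Proof.
case: q => [|q].
  by rewrite /border big_ord0 measure0 lee_fin mul0r mulr0.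
have mC := measurable_close_orbits R.
apply: le_trans (Boole_inequality (A := fun i => close_orbits R i q (r q.+1)
    `|` close_orbits R q i (r q.+1)) (muX2 R) _) _.
  by move=> i _; apply: measurableU; exact: mC.
apply: (@le_trans _ _ (\sum_(i < q.+1) (8 * r q.+1)%:E)).
  apply: lee_sum => i _; apply: le_trans (measureU2 _ _ _) _ => //; try exact: mC.
  rewrite (_ : 8 * _ = 4 * r q.+1 + 4 * r q.+1)%R; last by ring.
  by rewrite EFinD; apply: leeD; apply: muX2_close_le; exact: r_pos.
by rewrite sumEFin lee_fin sumr_const card_ord -[leLHS]mulr_natl mulrCA.
Qed.

Let box_le N e : (0 < e)%R -> muX2 R (box N e) <= (N%:R * (N%:R * (4 * e)))%:E.
Proof.
move=> e0; have mC := measurable_close_orbits R.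
apply: le_trans (Boole_inequality
    (A := fun i => \big[setU/set0]_(j < N) close_orbits R i j e) (muX2 R) _) _.
  by move=> i _; apply: bigsetU_measurable => j _; exact: mC.
apply: (@le_trans _ _ (\sum_(i < N) (N%:R * (4 * e))%:E)).
  apply: lee_sum => i _; apply: le_trans (Boole_inequality
    (A := fun j => close_orbits R i j e) (muX2 R) _) _ => [j _|].
    exact: mC.
  apply: (@le_trans _ _ (\sum_(i < N) (4 * e)%:E)).
    by apply: lee_sum => j _; exact: muX2_close_le.
  by rewrite sumEFin lee_fin sumr_const card_ord -[leLHS]mulr_natl.
by rewrite sumEFin lee_fin sumr_const card_ord -[leLHS]mulr_natl.
Qed.

(** Take a [k >= n] with the pair in [E_k]. If both times are below [N], use [r k <= r n]; otherwise
    [q = max(i, j) + 1] satisfies [N < q <= k], and [r k <= r q]. *)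
Let limsupE_sub N n : (0 < n)%N ->
  limsupE `<=` (\bigcup_(q in ~` `I_N) border q) `|` box N (r n).
Proof.
move=> n0 -[x y] /(_ n)[k nk]; rewrite E_setE => -[_ [i /= ik [j /= jk ij]]].
rewrite /close_orbits /= in ij.
have [/andP[iN jN]|h] := boolP ((i < N) && (j < N))%N.
  right; rewrite /box -(bigcup_mkord _
    (fun i => \big[setU/set0]_(j < N) close_orbits R i j (r n))).
  exists i => //; rewrite -(bigcup_mkord _ (fun j => close_orbits R i j (r n))).
  exists j => //=.
  by apply: lt_le_trans ij _; exact: r_dec.
left; exists (maxn i j).+1; first by rewrite /=; lia.
rewrite /border -(bigcup_mkord _ (fun k =>
  close_orbits R k _ (r _) `|` close_orbits R _ k (r _))); have [ij'|ji] := leqP i j.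
  exists i => //=; left; rewrite /close_orbits /=.
  by apply: lt_le_trans ij _; apply: r_dec; lia.
exists j => /=; first by lia.
by right; apply: lt_le_trans ij _; apply: r_dec; lia.
Qed.

(** Monotonicity of [n * r n] gives [r n <= r 1 / n]. *)
Let r_cvg0 (e : R) : (0 < e)%R -> exists2 n, (0 < n)%N & (r n <= e)%R.
Proof.
move=> e0; have r1 := r_pos 1 isT.
have [n hn] : exists n : nat, (r 1 / e < n%:R)%R.
  by exists (Num.truncn (r 1 / e)).+1; exact: truncnS_gt.
have n0 : (0 < n)%N.
  by rewrite -(ltr_nat R); apply: lt_trans hn; rewrite divr_gt0.
exists n => //; have := nr_dec _ _ (isT : 0 < 1)%N n0.
rewrite mul1r => h; have n0' : (0 < n%:R :> R)%R by rewrite ltr0n.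
rewrite -(ler_pM2l n0'); apply: le_trans h _.
by rewrite ltr_pdivrMr// in hn; exact: ltW.
Qed.

Lemma muX2_limsup_eq0 :
  \sum_(1 <= n <oo) ((n%:R * r n)%:E) < +oo -> muX2 R limsupE = 0.
Proof.
move=> S; apply/eqP; rewrite eq_le measure_ge0 andbT.
have mL : measurable limsupE.
  by apply: measurable_limsup => n; exact: measurable_E_set.
pose f n : \bar R := (8 * (n%:R * r n))%:E.
have f0 n : 0 <= f n by rewrite lee_fin mulr_ge0.
have Sf : \sum_(0 <= n <oo) f n < +oo.
  rewrite (nneseries_split 0 1)// big_nat1 /f mul0r mulr0 add0e.
  under eq_eseriesr do rewrite EFinM.
  rewrite nneseriesZl; last by move=> n _; rewrite lee_fin.
  by rewrite lte_mul_pinfty.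
apply: cvge_ge (nneseries_tail_cvg Sf _) => //.
apply: nearW => N; apply/lee_addgt0Pr => e e0.
(* This radius makes the box, of measure at most [4 * N ^ 2 * r n], smaller than [e]; the summand 1
   keeps the denominator positive at [N = 0]. *)
have [|n n0 rn] := r_cvg0 (e / (N%:R * (N%:R * 4) + 1)).
  by rewrite divr_gt0// ltr_wpDl// !mulr_ge0.
have bm : measurable (\bigcup_(q in ~` `I_N) border q).
  by apply: bigcup_measurable => q _.
apply: (@le_trans _ _ (muX2 R ((\bigcup_(q in ~` `I_N) border q) `|` box N (r n)))).
  apply: le_measure; rewrite ?inE//; last exact: limsupE_sub.
  exact: measurableU bm (measurable_box _ _).
apply: le_trans (measureU2 _ _ _) _; [exact: bm|exact: measurable_box|apply: leeD].
  apply: (@le_trans _ _ (\sum_(N <= q <oo) muX2 R (border q))).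
    apply: measure_sigma_subadditive_tail => //; exact: measurable_border.
  by apply: lee_nneseries => // q _; exact: border_le.
apply: le_trans (box_le _ _ (r_pos _ n0)) _; rewrite lee_fin.
rewrite ler_pdivlMr in rn; last by rewrite ltr_wpDl// !mulr_ge0.
by have := r_pos _ n0; lra.
Qed.
End Convergence.

(** * Divergent series: the limsup has full measure *)

Section Divergence.
Variables (R : realType) (r : nat -> R) (m : nat -> nat).
Hypothesis m_le : forall n : nat, (0 < n)%N -> 2^-1 ^+ m n <= r n.
Local Notation E n := (@E_set R n (r n)).

(** The square is half-open because the digit estimates need coordinates below 1. *)
Definition missed N : set (R * R) := (`[0, 1[%classic `*` `[0, 1[%classic) `&`
  [set p | forall n, (N <= n)%N -> ~ E n p].

Lemma measurable_missed N : measurable (missed N).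
Proof.
apply: measurableI; first by apply: measurableX; exact: measurable_itv.
rewrite (_ : mkset _ = ~` \bigcup_(n >= N) E n).
  apply: measurableC; apply: bigcup_measurable => n _.
  exact: measurable_E_set.
apply/seteqP; split => p /= h; first by move=> [n Nn]; exact: h.
by move=> n Nn En; apply: h; exists n.
Qed.

Section Window.
Variables N K : nat.

(** Enough digits to contain every match that starts at [i < K], [j <= i]. *)
Let M := (\max_(i < K) (i + m i.+2)).+1.
Local Notation W := (M.-tuple bool * M.-tuple bool)%type.

Let ltM (i : 'I_K) j : (j <= i)%N -> (j + m i.+2 < M)%N.
Proof.
move=> ji; rewrite ltnS; apply: leq_trans (leq_bigmax i).
by rewrite leq_add2r.
Qed.

(** The range conditions sit inside the event, which is empty outside them, so that the index type
    is a plain product. *)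
Let hit (p : 'I_K * 'I_K) : pred W := fun w =>
  [&& (N <= p.1)%N, (p.2 <= p.1)%N & new_match M p.1 p.2 (m p.1.+2) w].

Let cardW : #|{: W}| = (4 ^ M)%N.
Proof. by rewrite card_prod !card_tuple card_bool -expnMn. Qed.

Let hit_corr p q : p != q ->
  (#|[pred w | hit p w && hit q w]| * #|{: W}| <= #|hit p| * #|hit q|)%N.
Proof.
move=> pq; rewrite cardW.
have hitN (p' : 'I_K * 'I_K) w : ~~ ((N <= p'.1) && (p'.2 <= p'.1))%N -> hit p' w = false.
  by move=> h; rewrite /hit andbA (negPf h).
have [hp|hp] := boolP ((N <= p.1) && (p.2 <= p.1))%N; last first.
  by rewrite eq_card0 ?mul0n// => w; rewrite !inE hitN.
have [hq|hq] := boolP ((N <= q.1) && (q.2 <= q.1))%N; last first.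
  by rewrite eq_card0 ?mul0n// => w; rewrite !inE andbC hitN.
have hitE (p' : 'I_K * 'I_K) : (N <= p'.1)%N && (p'.2 <= p'.1)%N ->
    #|hit p'| = #|new_match M p'.1 p'.2 (m p'.1.+2)|.
  by move=> h; apply: eq_card => w; rewrite unfold_in /hit andbA h.
rewrite !hitE//; move/andP: (hp) => [_ ?]; move/andP: (hq) => [_ ?].
apply: leq_trans (card_new_matchI M p.1 p.2 _ q.1 q.2 _ _ _ _ _ _); try exact: ltM.
- rewrite leq_mul2r; apply/orP; right; apply: eq_leq; apply: eq_card => w.
  by rewrite !inE; congr andb; rewrite /hit andbA ?hp ?hq.
- apply: contra pq; case: (p) (q) => [p1 p2] [q1 q2] /=.
  by rewrite !xpair_eqE -!val_eqE.
Qed.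

(** For each [i] there are [i + 1] choices of [j <= i], each event having probability
    [2 ^ -(m (i + 2) + 1)]. *)
Definition expected_hits : R :=
  \sum_(i < K | (N <= i)%N) i.+1%:R * 2^-1 ^+ (m i.+2).+1.

Let sum_hit : (\sum_p #|hit p|)%:R = 4 ^+ M * expected_hits.
Proof.
rewrite natr_sum -(pair_bigA _ (fun i j => #|hit (i, j)|%:R)) /=.
rewrite /expected_hits mulr_sumr [RHS]big_mkcond; apply: eq_bigr => i _.
case: ifPn => Ni; last first.
  rewrite big1// => j _; rewrite eq_card0// => w.
  by rewrite unfold_in /hit (negPf Ni).
rewrite (eq_bigr (fun j : 'I_K =>
    if (j < i.+1)%N then 4 ^+ M * 2^-1 ^+ (m i.+2).+1 else 0)); last first.
  move=> j _; rewrite ltnS; case: ifPn => ji; last first.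
    rewrite eq_card0// => w.
    by rewrite unfold_in /hit /= (negPf ji) andbF.
  rewrite (eq_card (B := new_match M i j (m i.+2))); last first.
    by move=> w; rewrite unfold_in /hit Ni ji.
  have := card_new_match M i j (m i.+2) (ltM _ _ (leqnn _)) (ltM _ _ ji).
  move=> /(congr1 (fun n : nat => n%:R : R)); rewrite natrM !natrX => <-.
  by rewrite exprVn mulrAC divff ?mul1r// expf_neq0.
rewrite -big_mkcond -(big_ord_widen K (fun _ => _))//= sumr_const card_ord.
by rewrite -[LHS]mulr_natl mulrCA.
Qed.

Let code (p : R * R) : W :=
  ([tuple digit R p.1 k | k < M], [tuple digit R p.2 k | k < M]).

(** The dyadic square of side [2^-M] containing the pairs of the half-open unit square with code
    [w]. *)
Let cell (w : W) : set (R * R) :=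
  `[dyadic R w.1, dyadic R w.1 + 2^-1 ^+ M[%classic `*`
  `[dyadic R w.2, dyadic R w.2 + 2^-1 ^+ M[%classic.

Let cell_le w : (muX2 R (cell w) <= ((4 ^+ M)^-1)%:E)%E.
Proof.
rewrite [muX2 R _]product_measure1E; [|exact: measurable_itv..].
have M0 : 0 <= 2^-1 ^+ M :> R by rewrite exprn_ge0.
have -> : (4 ^+ M)^-1 = 2^-1 ^+ M * 2^-1 ^+ M :> R.
  by rewrite -exprMn -invfM exprVn; congr (_ ^+ _)^-1; ring.
rewrite EFinM; apply: lee_pmul => //; apply: le_trans (muX_itv_le _ _ _ _ _ _) _;
  by rewrite ?lerDl// addrAC subrr add0r.
Qed.

Let missed_code p : missed N p -> cell (code p) p /\ [forall q, ~~ hit q (code p)].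
Proof.
case: p => x y [[/=]]; rewrite !in_itv /= => x01 y01 nE.
have tupE (z : R) : [tuple digit R z k | k < M] = mkseq (digit R z) M :> seq bool.
  by rewrite /= map_comp val_enum_ord.
split.
  by split; [have := dyadic_digits R M _ x01|have := dyadic_digits R M _ y01];
    rewrite -tupE /= in_itv.
apply/forallP => -[i j]; apply/negP => /and3P[/= Ni ji /digits_differ_byP h].
apply: (nE i.+2); first by lia.
rewrite E_setE; split; first by split; rewrite /unitI /= in_itv /=; lra.
(* The run of agreement starts one position after the disagreement, hence the times [i + 1] and
   [j + 1], both below [i + 2]. *)
exists i.+1 => //=; exists j.+1 => /=; first by lia.
apply: lt_le_trans (m_le i.+2 isT).
apply: close_of_digits; try exact: doubling_itv.
move=> s sm; rewrite !digit_iter !addSnnS.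
have ns (z : R) k : (k < M)%N -> nth false [tuple digit R z k | k < M] k = digit R z k.
  by move=> kM; rewrite tupE nth_mkseq.
have iM : (i + s.+1 < M)%N by apply: leq_ltn_trans (ltM i i (leqnn _)); lia.
have jM : (j + s.+1 < M)%N by apply: leq_ltn_trans (ltM i j ji); lia.
by have := h s.+1 sm; rewrite !ns //=; case: digit; case: digit.
Qed.

(** Missed pairs have codes without hits. By [card_no_event] the number of such codes times
    [expected_hits] is at most [4 ^ M], and each cell has measure at most [4 ^ -M]. *)
Lemma muX2_missed_le : (muX2 R (missed N) * expected_hits%:E <= 1)%E.
Proof.
pose bad := [pred w : W | [forall q, ~~ hit q w]].
have e0 : 0 <= expected_hits.
  by apply: sumr_ge0 => i _; rewrite mulr_ge0// exprn_ge0.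
pose w0 : W := (nseq_tuple M false, nseq_tuple M false).
have cover : (muX2 R (missed N) <= (#|bad|%:R * (4 ^+ M)^-1)%:E)%E.
  apply: (@le_trans _ _ (\sum_(k < #|bad|) muX2 R (cell (nth w0 (enum bad) k)))).
    apply: (@content_subadditive _ _ _ (muX2 R) _ (fun k => cell (nth w0 (enum bad) k))) => [k _||].
    - by apply: measurableX; exact: measurable_itv.
    - exact: measurable_missed.
    - move=> p /missed_code[pc pb]; rewrite -(bigcup_mkord _ (fun k => cell (nth w0 (enum bad) k))).
      have cb : code p \in enum bad by rewrite mem_enum inE.
      exists (index (code p) (enum bad)); last by rewrite nth_index.
      by rewrite /= cardE index_mem.
  apply: (@le_trans _ _ (\sum_(k < #|bad|) ((4 ^+ M)^-1)%:E)).
    by apply: lee_sum => k _; exact: cell_le.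
  by rewrite sumEFin lee_fin sumr_const card_ord -[leLHS]mulr_natl.
apply: (@le_trans _ _ ((#|bad|%:R * (4 ^+ M)^-1)%:E * expected_hits%:E)%E).
  by apply: lee_wpmul2r => //; rewrite lee_fin.
have := card_no_event _ _ hit hit_corr.
rewrite -EFinM lee_fin -(ler_nat R) natrM sum_hit cardW natrX natrX -/bad.
have p0 : 0 < 4 ^+ M :> R by rewrite exprn_gt0.
move=> h; rewrite mulrAC ler_pdivrMr// mul1r -(ler_pM2l p0).
by rewrite -expr2; apply: le_trans h; rewrite mulrCA.
Qed.
End Window.

Hypothesis hits_unbounded :
  forall N (C : R), exists K, C <= expected_hits N K.

Lemma muX2_missed N : muX2 R (missed N) = 0%E.
Proof.
apply/eqP; rewrite eq_le measure_ge0 andbT leNgt; apply/negP.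
have /fineK <- : muX2 R (missed N) \is a fin_num.
  by apply: fin_num_measure; exact: measurable_missed.
set p := fine _; rewrite lte_fin => p0.
(* With this bound the product in [muX2_missed_le] would be at least 2. *)
have [K] := hits_unbounded N (2 / p); rewrite ler_pdivrMr// => hK.
have := muX2_missed_le N K; rewrite -(@fineK _ (muX2 R (missed N))); last first.
  by apply: fin_num_measure; exact: measurable_missed.
by rewrite -EFinM lee_fin -/p; lra.
Qed.

Lemma muX2_limsup_eq1 : muX2 R (limsup_set (fun n => E n)) = 1%E.
Proof.
set L := limsup_set _.
have mL : measurable L by apply: measurable_limsup => n; exact: measurable_E_set.
have mU : measurable (`[0, 1[%classic : set R) by exact: measurable_itv.
suff : muX2 R (~` L) = 0%E.
  by move=> L0; rewrite -[L]setCK probability_setC ?L0 ?sube0//; exact: measurableC.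
apply: (proj1 (negligibleP (muX2 R) (measurableC mL))).
(* A pair outside the limsup is missed from some [N] on, or has a coordinate outside the half-open
   interval, a null event. *)
apply: (@negligibleS _ _ _ (muX2 R) ((\bigcup_N missed N) `|`
   ((~` `[0, 1[%classic `*` setT) `|` (setT `*` ~` `[0, 1[%classic)))).
  move=> [x y] nL.
  have [xU|] := pselect (`[0, 1[%classic x); last by right; left.
  have [yU|] := pselect (`[0, 1[%classic y); last by right; right.
  left; apply: contrapT => nm; apply: nL => N; apply: contrapT => nE.
  apply: nm; exists N => //; split=> // n Nn En; apply: nE; by exists n.
apply: negligibleU.
  apply: negligible_bigcup => N.
  exact: (proj2 (negligibleP (muX2 R) (measurable_missed N)) (muX2_missed N)).
apply: negligibleU.
  apply/negligibleP; first by apply: measurableX => //; exact: measurableC.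
  rewrite [LHS]product_measure1E//; last exact: measurableC.
  by rewrite [X in (X * _)%E](muX_not_co01 R) mul0e.
apply/negligibleP; first by apply: measurableX => //; exact: measurableC.
rewrite [LHS]product_measure1E//; last exact: measurableC.
by rewrite [X in (_ * X)%E](muX_not_co01 R) mule0.
Qed.
End Divergence.

(** * Choice of dyadic scales and conclusion *)

Lemma sum_unbounded (R : realType) (u : nat -> R) :
  (forall n, 0 <= u n) -> (\sum_(1 <= n <oo) (u n)%:E = +oo)%E ->
  forall N (C : R), exists K, C <= \sum_(i < K | (N <= i)%N) u i.+2.
Proof.
move=> u0 S N C; apply: contrapT => /forallNP H.
pose B := C + \sum_(i < N.+2) u i.
(* If the sums from index [N + 2] on stayed below [C], adding the first [N + 2] terms would bound
   the whole series. *)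
suff : (\sum_(1 <= n <oo) (u n)%:E <= B%:E)%E by rewrite S leye_eq.
apply: lime_le; first by apply: is_cvg_nneseries => n _ _; rewrite lee_fin.
apply: nearW => K; rewrite sumEFin lee_fin.
have {}H := H K; move/negP: H; rewrite -ltNge => H.
have mono k l : (k <= l)%N -> \sum_(0 <= n < k) u n <= \sum_(0 <= n < l) u n.
  by move=> kl; rewrite [leRHS](big_cat_nat (n := k))//= lerDl sumr_ge0.
have split_le : \sum_(0 <= n < K.+2) u n <=
    \sum_(0 <= n < N.+2) u n + \sum_(i < K | (N <= i)%N) u i.+2.
  elim: (K) => [|k IH]; first by rewrite big_ord0 addr0; exact: mono.
  have [Nk|kN] := leqP N k; last first.
    by rewrite -[leLHS]addr0; apply: lerD; [apply: mono|apply: sumr_ge0].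
  have -> : \sum_(i < k.+1 | (N <= i)%N) u i.+2 =
      \sum_(i < k | (N <= i)%N) u i.+2 + u k.+2.
    by rewrite big_mkcond big_ord_recr /= Nk [in RHS]big_mkcond.
  by rewrite big_nat_recr//= addrA; apply: lerD.
apply: (@le_trans _ _ (\sum_(0 <= n < K.+2) u n)); last first.
  by apply: le_trans split_le _; rewrite big_mkord /B addrC lerD2r ltW.
case: (K) => [|k]; first by rewrite big_geq// sumr_ge0.
by apply: le_trans (mono k.+1 k.+3 (leqW (leqnSn _))); rewrite [leRHS]big_ltn// lerDr.
Qed.

(** [m n] is the least [k] with [2^-k <= r n]. If [k > 0], minimality gives [r n < 2 * 2^-k]; if
    [k = 0], then [r n <= r 1]. The constant [2 + r 1] covers both cases. *)
Lemma dyadic_scale (R : realType) (r : nat -> R)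
  (r_pos : forall n : nat, (0 < n)%N -> 0 < r n)
  (r_dec : forall n m : nat, (0 < n)%N -> (n <= m)%N -> r m <= r n) :
  exists m : nat -> nat, forall n, (0 < n)%N ->
    2^-1 ^+ m n <= r n /\ (2 + r 1)^-1 * r n <= 2^-1 ^+ m n.
Proof.
have /choice[m mP] : forall n, exists k, (0 < n)%N ->
    2^-1 ^+ k <= r n /\ (2 + r 1)^-1 * r n <= 2^-1 ^+ k.
  move=> n; have [->|n0] := posnP n; first by exists 0%N.
  have rn := r_pos n n0; have r1 := r_pos 1 isT.
  have ex : exists k, 2^-1 ^+ k <= r n.
    exists (Num.truncn (r n)^-1).+1; set k := (Num.truncn _).+1.
    rewrite exprVn invf_ple ?posrE ?exprn_gt0//.
    apply: le_trans (ltW (truncnS_gt _)) _; rewrite -/k -natrX ler_nat.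
    exact/ltnW/ltn_expl.
  case: (ex_minnP ex) => k kn kmin; exists k => _; split=> //.
  rewrite ler_pdivrMl; last by lra.
  case: k => [|k] in kn kmin *.
    by rewrite mulr1; have := r_dec 1 n isT n0; lra.
  have : r n < 2^-1 ^+ k by rewrite ltNge; apply/negP => /kmin; rewrite ltnn.
  rewrite exprS; nra.
by exists m.
Qed.

Theorem mainTheorem8 (R : realType) (r : nat -> R)
  (r_pos : forall n : nat, (0 < n)%N -> 0 < r n)
  (r_dec : forall n m : nat, (0 < n)%N -> (n <= m)%N -> r m <= r n)
  (nr_dec : forall n m : nat, (0 < n)%N -> (n <= m)%N ->
     m%:R * r m <= n%:R * r n) :
  let S := (\sum_(1 <= n <oo) ((n%:R * r n)%:E))%E in
  let P := (muX R \x muX R)%E (limsup_set (fun n => @E_set R n (r n))) in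
  ((S < +oo)%E -> P = 0%E) /\ (S = +oo%E -> P = 1%E).
Proof.
move=> S P; split=> hS; first exact: muX2_limsup_eq0 hS.
have [m mP] := dyadic_scale R r r_pos r_dec.
have c0 : 0 < (2 + r 1)^-1 by rewrite invr_gt0 ltr_wpDr// ltW// r_pos.
apply: (muX2_limsup_eq1 R r m) => [n n0|N C]; first by have [] := mP n n0.
have nr0 n : 0 <= n%:R * r n.
  by case: n => [|n]; rewrite ?mul0r// mulr_ge0// ltW// r_pos.
(* The factor 4 pays for [i + 2 <= 2 * (i + 1)] and for the extra equation of the initial
   disagreement; the other factor is the loss in [dyadic_scale]. *)
have [K hK] := sum_unbounded R _ nr0 hS N (4 * C / (2 + r 1)^-1).
exists K; rewrite ler_pdivrMr// in hK.
rewrite -(@ler_pM2l _ 4)//; apply: le_trans hK _.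
rewrite /expected_hits mulr_suml mulr_sumr; apply: ler_sum => i _.
have [_ h] := mP i.+2 isT; have := r_pos i.+2 isT.
have : 0 <= i%:R :> R by [].
rewrite exprS -(natr1 i.+1) -(natr1 i); move: h.
set c := _^-1; set x := _ ^+ m _; set a := i%:R; set b := r _ => h1 h2 h3.
have : (a + 1 + 1) * (c * b) <= (a + 1 + 1) * x by rewrite ler_wpM2l//; lra.
have x0 : 0 <= x by rewrite exprn_ge0.
have ax : 0 <= a * x by rewrite mulr_ge0.
rewrite -mulrA [b * c]mulrC => h4; apply: le_trans h4 _; lra.
Qed.
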